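(* For all integers $n\ge 0$ and $k\ge 0$, the map $e_\infty$ is a bijection from the set of even-special Dyck paths of length $n$ with exactly $k$ special steps to the set of little Schröder paths of length $n$ with exactly $k$ horizontal steps.
   Context: **Paths.** All lattice paths of length $n$ start at $(0,0)$, end at $(n,0)$, never go below the $x$-axis, and consist of upsteps U $=(1,1)$, downsteps $(1,-1)$, and double horizontal steps HH $=(2,0)$. A double horizontal step is treated as one indivisible ''horizontal step'' and contributes $2$ to the length. Each downstep is either ordinary (written D) or carries the label ''special'' (written d); paths with different labels are different. A Dyck path has no horizontal steps. A little Schröder path is a path of upsteps, ordinary downsteps and horizontal steps (no special steps) with no horizontal step at height $0$. An even-special Dyck path is a Dyck path in which an arbitrary subset of the downsteps that leave from even height (i.e. whose starting height is even) are labeled special. **Matching upstep.** The upstep matching a downstep $d$ is the rightmost upstep to the left of $d$ that ends at the height from which $d$ leaves. **The map $e$.** If a path has no special steps, $e$ leaves it unchanged. Otherwise take the leftmost special step $s$. (Flatten) If $s$ is immediately preceded by an upstep, replace that upstep and $s$ by one horizontal step HH. (Slide) If $s$ is immediately preceded by a downstep $d$ (necessarily ordinary), let $u$ be the upstep matching $d$ and let $P$ be the (possibly empty) subpath strictly between $u$ and $d$; replace the portion $u\,P\,d\,s$ of the path by HH $P$ D, i.e. replace $u$ with a horizontal step, delete $d$, let $P$ follow the horizontal step, and make $s$ an ordinary downstep. For paths obtained from even-special Dyck paths by repeatedly applying $e$ these are the only cases that occur. **The map $e_\infty$.** For an even-special Dyck path, $e_\infty$ is the result of applying $e$ repeatedly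 until no special step remains. *)

(* Defs.v *)
From HB Require Import structures.
From mathcomp Require Import all_boot all_order all_algebra.
From mathcomp Require Import classical_sets functions.

Set Implicit Arguments.
Unset Strict Implicit.
Unset Printing Implicit Defensive.

Import GRing.Theory.
Local Open Scope ring_scope.

(* [Down] is an ordinary downstep (D), [SDown] a special one (d), and [Horiz]
   a double horizontal step (HH), a single indivisible letter. *)
Inductive step := Up | Down | SDown | Horiz.

Definition step_eqb (s t : step) : bool :=
  match s, t with
  | Up, Up | Down, Down | SDown, SDown | Horiz, Horiz => true
  | _, _ => false
  end.

Lemma step_eqP : Equality.axiom step_eqb.
Proof. by case; case; constructor. Qed.

HB.instance Definition _ := hasDecEq.Build step step_eqP.

Definition step_width (s : step) : nat := if s is Horiz then 2 else 1.

Definition step_rise (s : step) : int :=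
  match s with Up => 1 | Down | SDown => -1 | Horiz => 0 end.

Definition path_length (p : seq step) : nat := (\sum_(s <- p) step_width s)%N.

(* If [p = p1 ++ s :: p2], the displayed step [s] leaves from height
   [height p1]. *)
Definition height (p : seq step) : int := \sum_(s <- p) step_rise s.

Definition lattice_path (n : nat) (p : seq step) : Prop :=
  [/\ path_length p = n,
      height p = 0
    & forall p1 p2, p = p1 ++ p2 -> 0 <= height p1].

Definition even_special_dyck (n : nat) (p : seq step) : Prop :=
  [/\ lattice_path n p,
      Horiz \notin p
    & forall p1 p2, p = p1 ++ SDown :: p2 -> (2 %| height p1)%Z].

Definition little_schroder (n : nat) (p : seq step) : Prop :=
  [/\ lattice_path n p,
      SDown \notin p
    & forall p1 p2, p = p1 ++ Horiz :: p2 -> height p1 <> 0].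

(* Index of the upstep matching the downstep at index [j]: the largest [m < j]
   such that step [m] is an upstep ending at the height from which step [j]
   leaves; [None] if there is no such upstep. *)
Definition matching_up (p : seq step) (j : nat) : option nat :=
  ohead [seq m <- rev (iota 0 j) |
          (nth Horiz p m == Up) && (height (take m.+1 p) == height (take j p))].

(* The leftmost special step has index [j.+1]. The branches returning [p] on a
   path with a special step are junk values, for configurations that are not
   reached from even-special Dyck paths. *)
Definition e_map (p : seq step) : seq step :=
  if SDown \notin p then p else
  if index SDown p is j.+1 then
    let r := drop j.+2 p in
    match nth Horiz p j with
    | Up => take j p ++ Horiz :: r
    | Down =>
        if matching_up p j is Some m then
          take m p ++ Horiz :: drop m.+1 (take j p) ++ Down :: r
        else p
    | _ => p
    end
  else p.

(* Outside the junk branches an application of [e_map] to a path with special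
   steps removes exactly one of them, so this number of iterations is the one
   at which no special step remains. *)
Definition e_inf (p : seq step) : seq step := iter (count_mem SDown p) e_map p.

(* Main.v *)
(* Since [e_map] acts on the leftmost special step and on nothing to its right,
   [e_inf] reads the path once from left to right, keeping a Schroeder prefix
   free of special steps: ordinary steps are appended, a special step is
   flattened or slid at the end of the prefix. The prefixes that arise are
   exactly those in which every horizontal step that the path never goes below
   afterwards lies at odd height. On them the last letter read can be recovered:
   a final HH comes from a flattening, a final U from an upstep, and a final D
   leaving from height [h] comes from a slide precisely when [h] is even and
   some horizontal step at height [h] is followed only by heights [>= h] up to
   that D. In this case the first such horizontal step is the one that was slid.
   At height 0 the condition on prefixes says that no horizontal step lies on the
   axis. *)
Require Import Defs.
From mathcomp Require Import all_boot all_order all_algebra.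
From mathcomp Require Import zify.
From mathcomp Require Import classical_sets functions.

Import Order.TTheory GRing.Theory Num.Theory.
Local Open Scope ring_scope.

(** * Splittings, heights and lengths of paths *)

Lemma cat_cons_split (T : Type) (x P y q : seq T) (s : T) :
  x ++ s :: P = y ++ q ->
  (exists2 m, y = x ++ s :: m & P = m ++ q) \/
  (exists2 m, x = y ++ m & q = m ++ s :: P).
Proof.
elim: x y => [|a x IHx] [|b y] /=.
- by move=> <-; right; exists [::].
- by case=> <- ->; left; exists y.
- by move=> <-; right; exists (a :: x).
case=> <- /IHx [] [m -> ->]; first by left; exists m.
by right; exists m.
Qed.

Lemma height_nil : height [::] = 0.
Proof. by rewrite /height big_nil. Qed.

Lemma height_cons s p : height (s :: p) = step_rise s + height p.
Proof. by rewrite /height big_cons. Qed.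

Lemma height_cat p q : height (p ++ q) = height p + height q.
Proof. by rewrite /height big_cat. Qed.

Lemma height_rcons p s : height (rcons p s) = height p + step_rise s.
Proof. by rewrite -cats1 height_cat height_cons height_nil addr0. Qed.

Definition heightE :=
  (height_rcons, height_cat, height_cons, height_nil).

Lemma path_length_nil : path_length [::] = 0%N.
Proof. by rewrite /path_length big_nil. Qed.

Lemma path_length_cons s p :
  path_length (s :: p) = (step_width s + path_length p)%N.
Proof. by rewrite /path_length big_cons. Qed.

Lemma path_length_cat p q :
  path_length (p ++ q) = (path_length p + path_length q)%N.
Proof. by rewrite /path_length big_cat. Qed.

Lemma path_length_rcons p s :
  path_length (rcons p s) = (path_length p + step_width s)%N.
Proof.
by rewrite -cats1 path_length_cat path_length_cons path_length_nil addn0.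
Qed.

Definition path_lengthE :=
  (path_length_rcons, path_length_cat, path_length_cons, path_length_nil).

(** * Nonnegative paths *)

(** The starting height is an argument so that the condition splits along concatenations and is
    monotone in [h]. *)
Fixpoint above (h : int) (p : seq step) : bool :=
  (0 <= h) && (if p is s :: p' then above (h + step_rise s) p' else true).

Lemma above_start h p : above h p -> 0 <= h.
Proof. by case: p => [|s p] /andP[]. Qed.

Lemma above_cat h p q :
  above h (p ++ q) = above h p && above (h + height p) q.
Proof.
elim: p h => [|s p IHp] h /=; last by rewrite IHp heightE addrA andbA.
rewrite heightE addr0 andbT; apply/idP/andP => [qP|[]//].
by split=> //; exact: above_start qP.
Qed.

Lemma above_cons h s p :
  above h (s :: p) = (0 <= h) && above (h + step_rise s) p.
Proof. by []. Qed.

Lemma above_end h p : above h p -> 0 <= h + height p.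
Proof. by rewrite -{1}[p]cats0 above_cat => /andP[_ /above_start]. Qed.

Lemma above_nil h : above h [::] = (0 <= h).
Proof. by rewrite /= andbT. Qed.

Lemma above_rcons h p s :
  above h (rcons p s) = above h p && (0 <= h + height p + step_rise s).
Proof.
rewrite -cats1 above_cat /= andbT; case pP: (above h p) => //=.
by rewrite (above_end _ _ pP).
Qed.

Lemma above_le h h' p : h <= h' -> above h p -> above h' p.
Proof.
elim: p h h' => [|s p IHp] h h' le_h; rewrite ?above_cons ?above_nil; first lia.
case/andP=> h0 pP; rewrite (le_trans h0 le_h) /=.
by apply: IHp pP; rewrite lerD2r.
Qed.

Lemma aboveP p :
  above 0 p <-> (forall p1 p2, p = p1 ++ p2 -> 0 <= height p1).
Proof.
split=> [pP p1 p2 def_p|].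
  by move: pP; rewrite def_p above_cat => /andP[/above_end]; rewrite add0r.
elim/last_ind: p => // p s IHp pP; rewrite above_rcons IHp /=.
  by rewrite add0r -height_rcons; apply: (pP _ [::]); rewrite cats0.
by move=> p1 p2 def_p; apply: (pP _ (rcons p2 s)); rewrite def_p rcons_cat.
Qed.

(** * Excursions and matching upsteps *)

Definition excursion (p : seq step) : bool := above 0 p && (height p == 0).

(** Provides the upstep matching a downstep read after [p]. A final downstep of [p] closes the
    excursion opened by one upstep; a second decomposition, of what precedes that upstep, gives the
    wanted one. *)
Lemma last_passage p : 0 < height p ->
  exists x P, p = x ++ Up :: P /\ excursion P.
Proof.
have [n] := ubnP (size p); elim: n p => // n IHn p; rewrite ltnS.
case/lastP: p => [|p s]; first by rewrite heightE.
rewrite size_rcons heightE => ltpn hp.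
have [def_s|[def_s|hs]] : s = Up \/ s = Horiz \/ step_rise s = -1.
- by case: s {hp} => /=; tauto.
- by exists p, [::]; rewrite cats1 def_s /excursion /= height_nil.
- move: hp; rewrite def_s addr0 => hp.
  have [||x [P [def_p /andP[P0 /eqP hP]]]] := IHn p => //.
  exists x, (rcons P Horiz); split; first by rewrite def_p rcons_cat.
  by rewrite /excursion above_rcons P0 !heightE hP.
have [||x [P [def_p /andP[P0 /eqP hP]]]] := IHn p; [by []|lia|].
have [||x' [P' [def_x /andP[P'0 /eqP hP']]]] := IHn x.
- by move: ltpn; rewrite def_p size_cat /=; lia.
- by move: hp; rewrite def_p !heightE hs hP /=; lia.
exists x', (P' ++ Up :: rcons P s); split.
  by rewrite def_p def_x !rcons_cat /= -catA.
rewrite /excursion above_cat above_cons above_rcons P'0 !heightE hP hP' hs /=.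
by rewrite (above_le 0).
Qed.

(** An upstep of [P] ending at the final level of [P] would start one below it, which an excursion
    forbids; so the displayed upstep is the last candidate. *)
Lemma matching_up_excursion x P r : excursion P ->
  matching_up (x ++ Up :: P ++ r) (size x + (size P).+1) = Some (size x).
Proof.
case/andP=> P0 /eqP hP.
have take_x k q : take (size x + k) (x ++ q) = x ++ take k q.
  by rewrite take_cat ltnNge leq_addr addKn.
rewrite /matching_up iotaD /= add0n rev_cat rev_cons.
rewrite -cats1 -catA !filter_cat /=.
rewrite (_ : [seq m <- rev (iota _ _) | _] = [::]) /=; last first.
  rewrite -(filter_pred0 (rev (iota (size x).+1 (size P)))).
  apply: eq_in_filter => m; rewrite mem_rev mem_iota => /andP[ltxm ltm].
  have{ltxm ltm} [i def_m lti]: exists2 i, m = (size x + i.+1)%N & (i < size P)%N.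
    by exists (m - (size x).+1)%N; lia.
  apply/negbTE/negP=> /andP[/eqP sU /eqP].
  move: sU; rewrite def_m nth_cat ltnNge leq_addr addKn /= nth_cat lti => sU.
  rewrite -addnS !take_x /= (@take_size_cat _ (size P)) //.
  have -> : take i.+1 (P ++ r) = rcons (take i P) Up.
    by rewrite takel_cat // (take_nth Horiz) // sU.
  move: P0; rewrite -{1}(cat_take_drop i P) above_cat => /andP[/above_end Pi _].
  by move: Pi; rewrite !heightE hP /=; lia.
rewrite nth_cat ltnn subnn eqxx /= -addn1 !take_x /= take0.
by rewrite take_size_cat // !heightE hP eqxx.
Qed.

(** * Reading one letter *)

(* [trans w s w']: reading the letter [s] turns the processed prefix [w] into
   [w']. *)
Inductive trans : seq step -> step -> seq step -> Prop :=
| TransUp w : trans w Up (rcons w Up)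
| TransDown w : trans w Down (rcons w Down)
| TransFlatten w : trans (rcons w Up) SDown (rcons w Horiz)
| TransSlide x P : excursion P ->
    trans (rcons (x ++ Up :: P) Down) SDown (rcons (x ++ Horiz :: P) Down).

Lemma e_map_trans w w' r : SDown \notin w -> trans w SDown w' ->
  e_map (w ++ SDown :: r) = w' ++ r.
Proof.
move=> wN tw; have idx : index SDown (w ++ SDown :: r) = size w.
  by rewrite index_cat (negbTE wN) /= addn0.
rewrite /e_map mem_cat in_cons eqxx orbT /= idx.
move: tw wN idx; move def_s: SDown => s tw; case: tw def_s => // [v|x P excP] _ _ _.
  rewrite size_rcons -!cats1 -!catA /= nth_cat ltnn subnn /=.
  by rewrite take_size_cat // drop_cat ltnNge leqW //= subSn // subSnn /= drop0.
rewrite size_rcons -!cats1 -!catA /= nth_cat size_cat ltnNge leq_addr addKn /=.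
rewrite nth_cat ltnn subnn /= matching_up_excursion //.
rewrite take_size_cat // -[_ :: P ++ _]/((Up :: P) ++ _) catA.
rewrite take_size_cat ?size_cat // -catA.
have drop_cat_add y k q : drop (size y + k) (y ++ q) = drop k q.
  by rewrite drop_cat ltnNge leq_addr addKn.
rewrite -(addn1 (size x)) -!addnS !drop_cat_add /= !drop0.
by rewrite -(addn2 (size P)) drop_cat_add /= drop0.
Qed.

Definition push (w : seq step) (s : step) : seq step :=
  if s is SDown then e_map (rcons w SDown) else rcons w s.

Lemma trans_push w s w' : SDown \notin w -> trans w s w' -> push w s = w'.
Proof.
move=> wN tw; case: tw wN (tw) => //= [v|x P excP] wN tw;
  by rewrite -cats1 (e_map_trans _ _ [::] wN tw) cats0.
Qed.

Lemma trans_height w s w' : trans w s w' -> height w' = height w + step_rise s.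
Proof. by case=> [v|v|v|x P _]; rewrite !heightE //=; lia. Qed.

Lemma trans_path_length w s w' :
  trans w s w' -> path_length w' = (path_length w + step_width s)%N.
Proof. by case=> [v|v|v|x P _]; rewrite !path_lengthE //=; lia. Qed.

Lemma trans_count w s w' : trans w s w' ->
  count_mem Horiz w' = (count_mem Horiz w + (s == SDown))%N.
Proof. by case=> [v|v|v|x P _]; rewrite -!cats1 !count_cat //=; lia. Qed.

(** * The condition on prefixes and its preservation *)

(* [above 0 P] says that the path never goes below the displayed horizontal step
   afterwards. *)
Definition reach (w : seq step) : Prop :=
  [/\ SDown \notin w, above 0 w
    & forall x P, w = x ++ Horiz :: P -> above 0 P -> ~~ (2 %| height x)%Z].

(** The letters that may extend a prefix of an even-special Dyck path ending at height [h]. *)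
Definition allowed (h : int) (s : step) : bool :=
  [&& s != Horiz, 0 <= h + step_rise s & (s == SDown) ==> (2 %| h)%Z].

Lemma rcons_cons_split (w x P : seq step) t s : rcons w t = x ++ s :: P ->
  (exists2 m, w = x ++ s :: m & P = rcons m t) \/ [/\ w = x, t = s & P = [::]].
Proof.
case/lastP: P => [|P t']; first by rewrite cats1 => /rcons_inj [-> ->]; right.
by rewrite -rcons_cons -rcons_cat => /rcons_inj [-> ->]; left; exists P.
Qed.

Lemma reach_rcons w t : t != SDown -> 0 <= height w + step_rise t ->
  (t = Horiz -> ~~ (2 %| height w)%Z) -> reach w -> reach (rcons w t).
Proof.
move=> tN ht oddw [wN w0 wV]; split.
- by rewrite mem_rcons in_cons negb_or eq_sym tN.
- by rewrite above_rcons w0 add0r.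
move=> x P /rcons_cons_split [[m def_w ->]|[<- /oddw //]].
by rewrite above_rcons => /andP[m0 _]; apply: wV def_w m0.
Qed.

(** Call a horizontal step visible if the path never goes below it afterwards. A letter that does
    not descend hides none, so removing it makes no other one visible. *)
Lemma reach_rcons_inv w t : 0 <= step_rise t -> reach (rcons w t) -> reach w.
Proof.
move=> ht [wN w0 wV]; split.
- by move: wN; rewrite mem_rcons in_cons negb_or => /andP[].
- by move: w0; rewrite above_rcons => /andP[].
move=> x P def_w P0; apply: (wV x (rcons P t)).
  by rewrite def_w rcons_cat.
by rewrite above_rcons P0 addr_ge0 ?(above_end _ _ P0).
Qed.

Lemma trans_exists w s : reach w -> allowed (height w) s ->
  exists w', trans w s w'.
Proof.
move=> [wN w0 wV] /and3P[]; case: s => //= _ hs ev.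
- by exists (rcons w Up); constructor.
- by exists (rcons w Down); constructor.
case/lastP: w wN w0 wV hs ev => [|w t]; first by rewrite heightE.
rewrite mem_rcons in_cons negb_or heightE => /andP[tN _] _ wV hs ev.
case: t tN wV hs ev => //= _ wV hs ev.
- by exists (rcons w Horiz); constructor.
(* Here [w] ends at height at least 2, since D and d can both follow it. *)
- have [|x [P [-> excP]]] := last_passage w; first lia.
  by exists (rcons (x ++ Horiz :: P) Down); constructor.
(* A final HH is visible, hence at odd height, whereas d leaves from even height. *)
by move: (wV w [::]); rewrite cats1 addr0 in ev *; rewrite ev => /(_ erefl isT).
Qed.

(** A flattened step lies one below the even height from which d leaves. After a slide, the final D
    goes below the new horizontal step and hides it along with those inside [P]; one in [x] that is
    visible now was visible before, as a slide only lowers the path. *)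
Lemma trans_reach w s w' :
  trans w s w' -> reach w -> allowed (height w) s -> reach w'.
Proof.
case=> {s w w'} [w|w|w|x P /andP[P0 /eqP hP]] rw /and3P[_ hs ev].
- exact: reach_rcons.
- exact: reach_rcons.
- have rw' : reach w by apply: reach_rcons_inv rw.
  apply: reach_rcons => // [|_].
    by case: rw' => _ /above_end; rewrite add0r addr0.
  by move: ev; rewrite heightE /=; lia.
move: hs ev; rewrite !heightE hP /= => hs ev.
case: rw => wN w0 wV; split.
- by move: wN; rewrite -!cats1 !mem_cat !in_cons.
- move: w0; rewrite !above_rcons !above_cat !above_cons => /andP[/and3P[-> h0 _] _].
  by rewrite !heightE hP h0 /=; apply/andP; split; [apply: above_le P0; lia|lia].
move=> x0 Q /rcons_cons_split [[m def_w ->]|[]//].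
rewrite above_rcons => /andP[m0 hm].
have [[m' def_x def_m]|[m' def_x def_m]] :=
  cat_cons_split _ _ _ _ _ _ (esym def_w).
  apply: (wV x0 (rcons (m' ++ Up :: P) Down)).
    by rewrite def_x -catA !rcons_cat.
  move: m0 hm; rewrite def_m above_rcons !above_cat !above_cons.
  move=> /and3P[-> h0 /= Pm]; rewrite !heightE hP h0 /= => hm.
  by apply/andP; split; [apply: above_le Pm; lia|lia].
case: m' {def_x} def_m => [[def_m]|a m' [_ def_m]].
  by move: hm; rewrite -def_m hP.
move: hP P0; rewrite def_m above_cat !heightE => hP /andP[/above_end hm' _].
by move: hm hP hm' => /=; lia.
Qed.

(** * Uniqueness of the last letter read *)

(* A horizontal step at even height before the slid one would already have been
   visible before the slide, so the slid step is the first of its kind. *)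
Lemma slide_clash x1 m P2 : excursion (m ++ Horiz :: P2) -> excursion P2 ->
  (2 %| height x1)%Z ->
  ~ reach (rcons ((x1 ++ Horiz :: m) ++ Up :: P2) Down).
Proof.
case/andP=> mP /eqP hmP /andP[P0 /eqP hP] ev [_ _ V].
suff: ~~ (2 %| height x1)%Z by rewrite ev.
apply: (V x1 (rcons (m ++ Up :: P2) Down)); first by rewrite -catA !rcons_cat.
move: mP hmP; rewrite above_cat !heightE hP /= !addr0 => /andP[m0 _] hm.
rewrite above_rcons above_cat above_cons m0 !heightE hP hm /=.
by rewrite (above_le 0).
Qed.

Lemma trans_inj w1 s1 v1 w2 s2 v2 : trans w1 s1 v1 -> trans w2 s2 v2 ->
  reach w1 -> allowed (height w1) s1 -> reach w2 -> allowed (height w2) s2 ->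
  v1 = v2 -> w1 = w2 /\ s1 = s2.
Proof.
(* A D and a slide cannot give the same result: the slid step would be visible, at even height, in
   the prefix to which D was appended. *)
have down_slide x P : reach (x ++ Horiz :: P) -> excursion P ->
    ~ allowed (height (rcons (x ++ Up :: P) Down)) SDown.
  move=> [_ _ V] /andP[P0 /eqP hP] /and3P[_ _].
  rewrite !heightE hP /= addr0 addrK => ev.
  by have := V x P erefl P0; rewrite ev.
case=> [w|w|w|x P eP]; case=> [w'|w'|w'|x' P' eP'] r1 a1 r2 a2 /rcons_inj [] //.
- by move=> def_w; case: (down_slide x' P') => //; rewrite -def_w.
- by move=> ->.
- by move=> def_w; case: (down_slide x P) => //; rewrite def_w.
have even_x y Q : excursion Q ->
    allowed (height (rcons (y ++ Up :: Q) Down)) SDown -> (2 %| height y)%Z.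
  by case/andP=> _ /eqP hQ /and3P[_ _]; rewrite !heightE hQ /= addr0 addrK.
(* If two slides with the same result slid different steps, the earlier of these would be visible at
   even height in the prefix where the later one is still an upstep. *)
move=> def_v; have [[m def_x def_P]|[m def_x def_P]] :=
  cat_cons_split _ _ _ _ _ _ def_v.
  case: (slide_clash x m P'); rewrite -?def_P -?def_x //.
  exact: even_x a1.
case: m def_x def_P => [|a m] def_x [].
  by move=> ->; rewrite def_x cats0.
move=> def_a def_P; rewrite -{a}def_a in def_x.
case: (slide_clash x' m P); rewrite -?def_P -?def_x //.
exact: even_x a2.
Qed.

(** * Existence of a last letter read *)

(** Decides how to undo a final D after [y]: remove it in the first case, turn the horizontal step
    found back into an upstep in the second. *)
Lemma reach_or_first_visible y : SDown \notin y -> above 0 y ->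
  reach y \/
  exists x P, [/\ y = x ++ Horiz :: P, above 0 P, (2 %| height x)%Z
    & forall x' P', y = x' ++ Horiz :: P' -> above 0 P' ->
        (2 %| height x')%Z -> (size x <= size x')%N].
Proof.
move=> yN y0; pose vis i := [&& (i < size y)%N, nth Up y i == Horiz,
  above 0 (drop i.+1 y) & (2 %| height (take i y))%Z].
have visP x P : y = x ++ Horiz :: P -> above 0 P -> (2 %| height x)%Z ->
    vis (size x).
  move=> def_y P0 ev; rewrite /vis def_y size_cat /= addnS ltnS leq_addr.
  rewrite nth_cat ltnn subnn eqxx take_size_cat // -cat_rcons.
  by rewrite drop_size_cat ?size_rcons // P0.
have [/hasP exv|/hasPn noV] := boolP (has vis (iota 0 (size y))); last first.
  left; split=> // x P def_y P0; apply/negP=> /(visP _ _ def_y P0) visx.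
  move: (visx) => /andP[ltx _].
  by have := noV (size x); rewrite mem_iota visx => /(_ ltx).
have{exv} exv : exists i, vis i by case: exv => i; exists i.
have [i /and4P[lti /eqP nthi P0 ev] min_i] := ex_minnP exv; right.
exists (take i y), (drop i.+1 y); split=> //.
  by rewrite -nthi -drop_nth // cat_take_drop.
move=> x' P' def_y P'0 ev'; rewrite size_take lti.
exact/min_i/(visP x' P').
Qed.

Lemma trans_onto w : reach w -> w != [::] ->
  exists w' s, [/\ reach w', allowed (height w') s & trans w' s w].
Proof.
case/lastP: w => [|y t] // rv _; have [vN v0 vV] := rv.
have /andP[tN yN] : (t != SDown) && (SDown \notin y).
  by move: vN; rewrite mem_rcons in_cons negb_or eq_sym.
have /andP[y0 ht] : above 0 y && (0 <= height y + step_rise t).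
  by move: v0; rewrite above_rcons add0r.
have hy : 0 <= height y by have := above_end _ _ y0; rewrite add0r.
case: t tN rv vN v0 vV ht => // _ rv _ _ vV ht.
- exists y, Up; split; [exact: reach_rcons_inv rv|by rewrite /allowed ht|].
  exact: TransUp.
- have [ry|[x [P [def_y P0 ev min_x]]]] := reach_or_first_visible _ yN y0.
    by exists y, Down; split; [|rewrite /allowed ht|exact: TransDown].
  (* Otherwise this horizontal step would stay visible after the final D, at even height. *)
  have hP : height P = 0.
    have := above_end _ _ P0; rewrite add0r le_eqVlt => /orP[/eqP//|hP].
    suff: ~~ (2 %| height x)%Z by rewrite ev.
    apply: (vV x (rcons P Down)); first by rewrite def_y rcons_cat.
    by rewrite above_rcons P0 /=; lia.
  have hx : height y = height x by rewrite def_y !heightE hP /=; lia.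
  have x0 : above 0 x by move: y0; rewrite def_y above_cat => /andP[].
  exists (rcons (x ++ Up :: P) Down), SDown; split; last first.
  + by rewrite def_y; apply: TransSlide; rewrite /excursion P0 hP.
  + by rewrite /allowed !heightE hP /= addr0 addrK ev -hx ht.
  split.
  + by move: yN; rewrite def_y mem_rcons in_cons !mem_cat !in_cons.
  + rewrite above_rcons above_cat above_cons x0 !heightE hP add0r -hx hy /=.
    by apply/andP; split; [apply: above_le P0; lia|lia].
  move=> x1 Q /rcons_cons_split [[m def_x ->]|[]//].
  rewrite above_rcons => /andP[m0 hm].
  have [[m' def_x1 def_m]|[m' _ def_m]] :=
    cat_cons_split _ _ _ _ _ _ (esym def_x).
    (* A horizontal step of [x] visible here is visible in [y] too, so even height would contradict
       the minimality of [x]. *)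
    apply/negP=> ev1; have := min_x x1 (m' ++ Horiz :: P).
    move: m0; rewrite def_m above_cat => /andP[m0 _].
    have m'0 := above_end _ _ m0.
    rewrite def_y {1}def_x1 -catA => /(_ erefl).
    rewrite above_cat m0 above_cons m'0 (above_le 0) ?addr0 //.
    by move=> /(_ isT ev1); rewrite def_x1 size_cat /=; lia.
  case: m' def_m => [//|a m' [_ def_m]].
  move: hP P0; rewrite def_m above_cat !heightE => hP /andP[/above_end hm' _].
  by move: hm hP hm' => /=; lia.
exists (rcons y Up), SDown.
(* The final HH is visible, hence at odd height; the restored d leaves one higher, from even
   height. *)
have oddy : ~~ (2 %| height y)%Z by apply: (vV y [::]); rewrite ?cats1.
split; last exact: TransFlatten.
- apply: reach_rcons => //=; first by lia.
  exact: reach_rcons_inv rv.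
- by rewrite /allowed heightE /=; apply/andP; split; lia.
Qed.

(** * Reading a whole path *)

Definition dyck_prefix (p : seq step) : Prop :=
  [/\ above 0 p, Horiz \notin p
    & forall p1 p2, p = p1 ++ SDown :: p2 -> (2 %| height p1)%Z].

Lemma dyck_prefix_rcons p s :
  dyck_prefix (rcons p s) <-> dyck_prefix p /\ allowed (height p) s.
Proof.
rewrite /dyck_prefix /allowed above_rcons mem_rcons in_cons negb_or add0r eq_sym.
split=> [[/andP[p0 ->] /andP[-> pN] pV]|[[p0 pN pV] /and3P[-> -> ev]]].
  split; last by apply/implyP=> /eqP def_s; apply: (pV p [::]); rewrite def_s cats1.
  by split=> // p1 p2 def_p; apply: (pV p1 (rcons p2 s)); rewrite def_p rcons_cat.
split=> //; first by rewrite p0.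
move=> p1 p2 /rcons_cons_split [[m def_p _]|[<- def_s _]]; first exact: pV def_p.
by move: ev; rewrite def_s.
Qed.

Lemma dyck_prefix_nil : dyck_prefix [::].
Proof. by split=> // -[]. Qed.

Lemma reach_nil : reach [::].
Proof. by split=> // -[]. Qed.

Lemma push_trans w s :
  reach w -> allowed (height w) s -> trans w s (push w s).
Proof.
move=> rw ok; have [w' tw] := trans_exists w s rw ok.
by rewrite (trans_push _ _ _ _ tw) //; case: rw.
Qed.

Definition slide_path (p : seq step) : seq step := foldl push [::] p.

Lemma slide_path_reach p : dyck_prefix p ->
  [/\ reach (slide_path p), height (slide_path p) = height p,
      path_length (slide_path p) = path_length p
    & count_mem Horiz (slide_path p) = count_mem SDown p].
Proof.
elim/last_ind: p => [|p s IHp]; first by split=> //; exact: reach_nil.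
case/dyck_prefix_rcons=> /IHp [rp hp lp cp] ok.
rewrite /slide_path foldl_rcons -/(slide_path p).
have ok' : allowed (height (slide_path p)) s by rewrite hp.
have tp := push_trans _ _ rp ok'.
split; first exact: trans_reach tp rp ok'.
- by rewrite (trans_height _ _ _ tp) heightE hp.
- by rewrite (trans_path_length _ _ _ tp) path_lengthE lp.
- by rewrite (trans_count _ _ _ tp) -cats1 count_cat cp /= addn0.
Qed.

Lemma slide_path_trans p s : dyck_prefix (rcons p s) ->
  trans (slide_path p) s (slide_path (rcons p s)).
Proof.
case/dyck_prefix_rcons=> /slide_path_reach [rp hp _ _] ok.
by rewrite /slide_path foldl_rcons; apply: push_trans => //; rewrite hp.
Qed.

(** The unread part [r] is arbitrary so that the induction can move the last letter of [p] into it;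
    only a special letter costs a further iteration. *)
Lemma iter_e_map p r : dyck_prefix p ->
  iter (count_mem SDown p) e_map (p ++ r) = slide_path p ++ r.
Proof.
elim/last_ind: p r => [|p s IHp] r // dps.
have tp := slide_path_trans _ _ dps.
case/dyck_prefix_rcons: dps => dp ok.
rewrite -cats1 count_cat /= addn0 addnC iterD -catA IHp // cats1.
have [[wN _ _] _ _ _] := slide_path_reach _ dp.
case: s {ok} tp => tp /=; try by rewrite /slide_path foldl_rcons cat_rcons.
exact: e_map_trans.
Qed.

Lemma e_inf_slide_path p : dyck_prefix p -> e_inf p = slide_path p.
Proof. by move=> dp; have := iter_e_map _ [::] dp; rewrite !cats0. Qed.

Lemma slide_path_inj p q : dyck_prefix p -> dyck_prefix q ->
  slide_path p = slide_path q -> p = q.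
Proof.
(* Lengths are preserved, so this settles the cases where one path is empty. *)
have nil_length r : path_length r = 0%N -> r = [::].
  by case: r => // s r; rewrite path_lengthE; case: s.
elim/last_ind: p q => [|p s IHp] q dp dq eq_pq.
  apply/esym/nil_length; have [_ _ <- _] := slide_path_reach _ dq.
  by rewrite -eq_pq path_lengthE.
case/lastP: q dq eq_pq => [|q t] dq eq_pq.
  apply: nil_length; have [_ _ <- _] := slide_path_reach _ dp.
  by rewrite eq_pq path_lengthE.
have tp := slide_path_trans _ _ dp; have tq := slide_path_trans _ _ dq.
case/dyck_prefix_rcons: dp => dp okp; case/dyck_prefix_rcons: dq => dq okq.
have [rp hp _ _] := slide_path_reach _ dp.
have [rq hq _ _] := slide_path_reach _ dq.
rewrite -hp in okp; rewrite -hq in okq.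
have [/IHp -> // ->] := trans_inj _ _ _ _ _ _ tp tq rp okp rq okq eq_pq.
by [].
Qed.

Lemma slide_path_onto w : reach w ->
  exists2 p, dyck_prefix p & slide_path p = w.
Proof.
(* Induction on [path_length], because undoing a flattening or a slide keeps the number of
   letters. *)
have [n] := ubnP (path_length w); elim: n w => // n IHn w ltwn rw.
have [->|nzw] := eqVneq w [::].
  by exists [::]; first exact: dyck_prefix_nil.
have [w' [s [rw' ok tw]]] := trans_onto _ rw nzw.
have [|p dp def_w'] := IHn w' _ rw'.
  by move: ltwn; rewrite (trans_path_length _ _ _ tw); case: s {ok tw} => /=; lia.
exists (rcons p s).
  have [_ hp _ _] := slide_path_reach _ dp.
  by apply/dyck_prefix_rcons; rewrite -hp def_w'.
rewrite /slide_path foldl_rcons -/(slide_path p) def_w'.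
by apply: trans_push tw; case: rw'.
Qed.

(** * Paths ending on the axis and the bijection *)

Lemma even_special_dyckE n p :
  even_special_dyck n p <->
  [/\ dyck_prefix p, path_length p = n & height p = 0].
Proof.
split=> [[[lp hp /aboveP p0] pN pV]|[[p0 pN pV] lp hp]] //.
by split=> //; split=> //; apply/aboveP.
Qed.

(** In a nonnegative path ending at height 0 the visible horizontal steps are exactly those on the
    axis, and 0 is even. *)
Lemma little_schroderE n q :
  little_schroder n q <-> [/\ reach q, path_length q = n & height q = 0].
Proof.
split=> [[[lq hq /aboveP q0] qN qV]|[[qN q0 qV] lq hq]].
  split=> //; split=> // x P def_q P0; have [] := qV x P def_q.
  move: q0 (above_end _ _ P0) hq; rewrite def_q above_cat !heightE.
  by move=> /andP[/above_end hx _] hP /=; lia.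
split=> // [|x P def_q hx]; first by split=> //; apply/aboveP.
have := qV x P def_q; rewrite hx dvdz0 => /(_ _)/negP[] //.
move: q0; rewrite def_q above_cat above_cons hx => /and3P[_ _].
by rewrite !addr0.
Qed.

Local Open Scope classical_set_scope.

Theorem corollary4 (n k : nat) :
  set_bij
    [set p : seq step | even_special_dyck n p /\ count_mem SDown p = k]
    [set q : seq step | little_schroder n q /\ count_mem Horiz q = k]
    e_inf.
Proof.
split.
- move=> p [/even_special_dyckE [dp lp hp] cp] /=.
  rewrite e_inf_slide_path //.
  have [rp hsp lsp csp] := slide_path_reach _ dp; split; last by rewrite csp.
  by apply/little_schroderE; rewrite lsp hsp.
- move=> p q; rewrite !inE => -[/even_special_dyckE [dp _ _] _].
  move=> [/even_special_dyckE [dq _ _] _].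
  by rewrite !e_inf_slide_path //; exact: slide_path_inj.
move=> w [/little_schroderE [rw lw hw] cw].
have [p dp def_w] := slide_path_onto _ rw.
have [_ hp lp cp] := slide_path_reach _ dp.
exists p; last by rewrite e_inf_slide_path.
split; last by rewrite -cp def_w.
by apply/even_special_dyckE; rewrite -lp -hp def_w.
Qed.
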